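(* Let $Q$ be a finite automorphic loop. If every element of $Q$ has order a power of $2$, then $Q$ is a $2$-loop, i.e. $|Q|=2^m$ for some $m$.
   Context: A loop is a set with a binary operation in which left and right division are uniquely solvable and which has a neutral element $1$. $\mathrm{Mlt}(Q)$ is the group generated by all left and right translations and $\mathrm{Inn}(Q)$ is the stabilizer of $1$ in it; $Q$ is automorphic if $\mathrm{Inn}(Q)\le\mathrm{Aut}(Q)$. Automorphic loops are power-associative, so the order of an element is the order of the cyclic group it generates. *)

(* Defs.v *)
From mathcomp Require Import all_boot all_fingroup.
Set Implicit Arguments. Unset Strict Implicit. Unset Printing Implicit Defensive.

Record loop (T : finType) := Loop {
  lmul : T -> T -> T;
  lone : T;
  lone_l : forall x, lmul lone x = x;
  lone_r : forall x, lmul x lone = x;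
  ldiv_uniq : forall a b, exists! x, lmul a x = b;
  rdiv_uniq : forall a b, exists! y, lmul y a = b
}.

Section LoopDefs.
Variables (T : finType) (Q : loop T).

Lemma Ltrans_inj (a : T) : injective (lmul Q a).
Proof.
move=> x y Hxy; have [z [_ Hz]] := ldiv_uniq Q a (lmul Q a x).
by rewrite -(Hz x erefl) (Hz y (esym Hxy)).
Qed.

Lemma Rtrans_inj (a : T) : injective (fun x => lmul Q x a).
Proof.
move=> x y Hxy; have [z [_ Hz]] := rdiv_uniq Q a (lmul Q x a).
by rewrite -(Hz x erefl) (Hz y (esym Hxy)).
Qed.

Definition Lperm (a : T) : {perm T} := perm (@Ltrans_inj a).
Definition Rperm (a : T) : {perm T} := perm (@Rtrans_inj a).

Definition lldiv (a b : T) : T := ((Lperm a)^-1)%g b.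
Definition lrdiv (b a : T) : T := ((Rperm a)^-1)%g b.

Definition Mlt : {set {perm T}} :=
  <<[set Lperm a | a : T] :|: [set Rperm a | a : T]>>%g.

Definition Inn : {set {perm T}} := [set f in Mlt | f (lone Q) == lone Q].

Definition automorphic : Prop :=
  forall f : {perm T}, f \in Inn ->
    forall x y, f (lmul Q x y) = lmul Q (f x) (f y).

Definition subloop_closed (S : {set T}) : bool :=
  (lone Q \in S) &&
  [forall a in S, forall b in S,
     [&& lmul Q a b \in S, lldiv a b \in S & lrdiv a b \in S]].

Definition subloop_gen (A : {set T}) : {set T} :=
  [set y | [forall S : {set T}, (subloop_closed S && (A \subset S)) ==> (y \in S)]].

Definition elt_order (x : T) : nat := #|subloop_gen [set x]|.

End LoopDefs.

(* Main.v *)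
(* Let [G] be the multiplication group and [J] the inversion map.  Automorphic loops satisfy
   [(a b)^-1 = b^-1 a^-1], so [J] normalizes [G] and conjugates [L_a] into the right
   translation by [a^-1].  Inner mappings commute with [J], hence the conjugates of [J] under
   [<G, J>] are the [J ^ L_a], and [P_a := J J^{L_a}] satisfies [P_a^2 = P_{a a}].  If
   iterated squares reach the neutral element, every [P_a] is therefore a 2-element, and
   Baer-Suzuki puts [J] and all [P_a] into the 2-core.
   If [O_2(G)] is nontrivial, its orbits form a congruence with classes of equal 2-power
   size, and we pass to the quotient loop.  Otherwise all [P_a] are trivial, which says that
   the loop is commutative of exponent 2.  In that case
   [m x y z := x ((x \ y) (x \ z))] is a totally symmetric operation with [m x x z = z]
   whose translations [m x y] are automorphisms of [m].  For a fixed [e], solving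
   [m x y w = e] for [w] gives an elementary abelian 2-group law on the loop. *)
Require Import Defs.
From mathcomp Require Import all_boot all_fingroup all_solvable.
Set Implicit Arguments. Unset Strict Implicit. Unset Printing Implicit Defensive.

(** * Totally symmetric ternary operations *)

Section TernaryAlgebra.

Local Open Scope group_scope.

Variables (T : finType) (m : T -> T -> T -> T).
Hypotheses (m12 : forall a b c, m a b c = m b a c)
           (m23 : forall a b c, m a b c = m a c b)
           (mxx : forall a b, m a a b = b)
           (m_inj : forall a b, injective (m a b))
           (mD : forall a b x y z,
                   m a b (m x y z) = m (m a b x) (m a b y) (m a b z)).

Lemma m31 a b c : m a b c = m c a b. Proof. by rewrite m23 m12. Qed.

Lemma m13 a b c : m a b c = m c b a. Proof. by rewrite m12 m31 m12 m23. Qed.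

Lemma m_l a b : m a b a = b. Proof. by rewrite m23 mxx. Qed.

Lemma m_r a b : m a b b = a. Proof. by rewrite m31 m_l. Qed.

Definition mdiv a b : T -> T := finv (m a b).

Lemma mdivK a b : cancel (mdiv a b) (m a b).
Proof. exact: f_finv (@m_inj a b). Qed.

Lemma mK a b : cancel (m a b) (mdiv a b).
Proof. exact: finv_f (@m_inj a b). Qed.

Lemma mdivE a b c d : m a b c = d -> mdiv a b d = c.
Proof. by move<-; rewrite mK. Qed.

Lemma mdivD a b x y z :
  mdiv a b (m x y z) = m (mdiv a b x) (mdiv a b y) (mdiv a b z).
Proof. by apply: (@m_inj a b); rewrite mD !mdivK. Qed.

(** Let [n1] and [n2] be the preimages of [q] and [w] under the automorphism [m e y]. Applying
    [m e z] shows [m n2 n1 e = x], and the image of this identity under [m e y] is the claim. *)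
Lemma m_exchange e q w x y z :
  m w q z = m e z y -> m w q x = e -> m e x y = m w q y.
Proof.
move=> eqr eqe; pose n1 := mdiv e y q; pose n2 := mdiv e y w.
have e1 : m e y n1 = q by exact: mdivK.
have e2 : m e y n2 = w by exact: mdivK.
have f1 : m e z n1 = m q z x.
  apply: (@m_inj z (m w q z)).
  have := mD e z e y n1; rewrite e1 m_l -eqr => <-.
  have := mD q z w q x; rewrite eqe m_l [m q z w]m31 [m (m w q z) _ _]m12 => <-.
  exact: m13.
have f2 : m e z n2 = m w z x.
  apply: (@m_inj z (m w q z)).
  have := mD e z e y n2; rewrite e2 m_l -eqr => <-.
  have := mD w z w q x; rewrite eqe m_l [m w z q]m23 => <-.
  exact: m13.
have ex : m n2 n1 e = x.
  apply: (@m_inj e z); rewrite mD f1 f2 m_l.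
  have := mD z x w q x; rewrite eqe m_r [m z x w]m31 [m z x q]m31 => <-.
  exact: m31.
by rewrite [LHS]m23 -[in LHS]ex mD e1 e2 m_l.
Qed.

(* The bijections [h := (m y z)^-1 \o m v z] and [k := (m y w)^-1 \o m v w] are
   automorphisms of [m] that exchange [y] and [v]; the claim expresses that they
   commute at [w], and [m_exchange] is what makes them do so. *)
Lemma m_coplanar e w y z x v c :
  m w y x = e -> m w z v = e -> m y z c = e -> m c x v = e.
Proof.
move=> ex ev ec.
pose h u := mdiv y z (m v z u); pose k u := mdiv y w (m v w u).
have hD a b d : h (m a b d) = m (h a) (h b) (h d) by rewrite /h mD mdivD.
have kD a b d : k (m a b d) = m (k a) (k b) (k d) by rewrite /k mD mdivD.
have hE a b : m y z b = m v z a -> h a = b by exact: mdivE.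
have kE a b : m y w b = m v w a -> k a = b by exact: mdivE.
have h_inj : injective h by move=> a b /(can_inj (mdivK _ _)) /m_inj.
pose t := mdiv v z (m y z w); pose z' := mdiv v z y; pose y0 := mdiv v w y.
have et : m v z t = m y z w by exact: mdivK.
have ez' : m v z z' = y by exact: mdivK.
have ey0 : m v w y0 = y by exact: mdivK.
have hy : h y = v by apply/hE/m13.
have hv : h v = y by apply: hE; rewrite !m_l.
have ht : h t = w by apply: hE.
have hz' : h z' = z by apply: hE; rewrite ez' m_r.
have hw : h w = c by apply: hE; rewrite ec -ev m13.
have tz' : m y z' t = m v w z'.
  by apply: h_inj; rewrite !hD hy hv hz' ht hw [RHS]m23 ec m13 ev.
(* Since [k y0 = w] and [h w = c], the commutation amounts to [k (h y0) = c]. *)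
pose y1 := h y0.
have y1E : m v y1 w = m c y w.
  have := @m_exchange y v w y0 t z'.
  rewrite [m w v z']m12 [m w v y0]m12 tz' ey0 => /(_ erefl erefl) /(congr1 h).
  by rewrite !hD hy hv ht hw -/y1 [RHS]m31 [RHS]m31.
have ky : k y = v by apply/kE/m13.
have kv : k v = y by apply: kE; rewrite !m_l.
have kz : k z = x by apply: kE; rewrite m12 ex -ev m31.
have ky1 : k y1 = c by apply: kE; rewrite [RHS]m23 y1E m31 m13 m12.
have ky0 : k y0 = w by apply: kE; rewrite m_r ey0.
have := congr1 k (mdivK y z (m v z y0)); rewrite -/(h y0) -/y1 !kD ky kv kz ky1 ky0.
by rewrite [LHS]m13 => ->; rewrite [LHS]m31 ex.
Qed.

(** By [m_coplanar] the maps [s x] are closed under composition, and [s x] sends [e] to [x]. They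
    form a group with as many elements as [T], all of order at most 2, so Cauchy's theorem leaves 2
    as the only prime divisor. *)
Lemma card_ternary (e : T) : exists k, #|T| = (2 ^ k)%N.
Proof.
pose dia x y := mdiv x y e.
have diaE x y z : m x y z = e -> dia x y = z by exact: mdivE.
have diaK x y : m x y (dia x y) = e by exact: mdivK.
have diaxx x : dia x x = e by apply: diaE; rewrite mxx.
have dia1 x : dia x e = x by apply: diaE; rewrite m_l.
have diaKK x : involutive (dia x).
  by move=> y; apply: diaE; rewrite m23 diaK.
have diaM x y z : dia (dia x y) (dia x z) = dia y z.
  by apply: diaE; rewrite m31; apply: (@m_coplanar e x y z).
have dia_inj x : injective (dia x) := inv_inj (diaKK x).
pose s x := perm (dia_inj x).
have sM x y : s x * s y = s (dia x y).
  by apply/permP=> z; rewrite permM !permE -(diaM x) diaKK.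
have s1 : s e = 1.
  by apply/permP=> z; rewrite permE perm1; apply: diaE; rewrite m_r.
have gA : group_set [set s x | x : T].
  apply/group_setP; split; first by rewrite -s1 imset_f.
  by move=> _ _ /imsetP[x _ ->] /imsetP[y _ ->]; rewrite sM imset_f.
have s_inj : injective s.
  by move=> x y /permP/(_ e); rewrite !permE !dia1.
have : 2.-group (Group gA).
  apply/pgroupP=> p p_pr /(Cauchy p_pr)[_ /imsetP[x _ ->] ord_p].
  by rewrite inE /= -dvdn_prime2 // -ord_p order_dvdn expgS expg1 sM diaxx s1.
by move/card_pgroup; rewrite card_imset // => ->; exists (logn 2 #|T|).
Qed.

End TernaryAlgebra.

(** * Automorphic loops *)

Section LoopTheory.

Local Open Scope group_scope.

Variables (T : finType) (Q : loop T).
Local Notation "x '**' y" := (lmul Q x y) (at level 40, left associativity).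
Local Notation one := (lone Q).
Local Notation L := (Lperm Q).
Local Notation R := (Rperm Q).
Local Notation ldiv := (lldiv Q).

Lemma LpermE a x : L a x = a ** x. Proof. by rewrite permE. Qed.

Lemma RpermE a x : R a x = x ** a. Proof. by rewrite permE. Qed.

Lemma ldivE a b : (L a)^-1 b = ldiv a b. Proof. by []. Qed.

Lemma ldivK a b : a ** ldiv a b = b. Proof. by rewrite -LpermE permKV. Qed.

Lemma mulKl a b : ldiv a (a ** b) = b. Proof. by rewrite -LpermE /lldiv permK. Qed.

Lemma ldivxx a : ldiv a a = one.
Proof. by rewrite -{2}[a](lone_r Q) mulKl. Qed.

Lemma mul_injl a b c : a ** b = a ** c -> b = c. Proof. exact: Ltrans_inj. Qed.

Lemma L_one : L one = 1.
Proof. by apply/permP=> x; rewrite LpermE lone_l perm1. Qed.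

Lemma R_one : R one = 1.
Proof. by apply/permP=> x; rewrite RpermE lone_r perm1. Qed.

Lemma L_Mlt a : L a \in Mlt Q.
Proof. by rewrite mem_gen // inE imset_f. Qed.

Lemma R_Mlt a : R a \in Mlt Q.
Proof. by rewrite mem_gen // inE imset_f ?orbT. Qed.

Hypothesis autQ : automorphic Q.

Section InnerMaps.

Variable f : {perm T}.
Hypothesis Innf : f \in Inn Q.

Lemma innM x y : f (x ** y) = f x ** f y. Proof. exact: autQ. Qed.

Lemma inn1 : f one = one. Proof. by move: Innf; rewrite inE => /andP[_ /eqP]. Qed.

Lemma inn_ldiv x y : f (ldiv x y) = ldiv (f x) (f y).
Proof. by apply: (@mul_injl (f x)); rewrite -innM !ldivK. Qed.

Lemma innL x : L x * f = f * L (f x).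
Proof. by apply/permP=> y; rewrite !permM !LpermE innM. Qed.

End InnerMaps.

Lemma innP f : f \in Mlt Q -> f one = one -> f \in Inn Q.
Proof. by move=> Gf f1; rewrite inE Gf f1 eqxx. Qed.

(** The left inner mapping; products of permutations act from left to right, so [L y] comes
    first. *)
Definition linn x y := L y * L x * (L (x ** y))^-1.

Lemma linnE x y z : linn x y z = ldiv (x ** y) (x ** (y ** z)).
Proof. by rewrite !permM !LpermE ldivE. Qed.

Lemma linn_Inn x y : linn x y \in Inn Q.
Proof.
apply: innP; first by rewrite !groupM ?groupV ?L_Mlt.
by rewrite linnE lone_r ldivxx.
Qed.

(** The map [t], sending [z] to [x \ (z x)], is an automorphism fixing [x]; evaluate it at [x y]. *)
Lemma flexible x y : x ** (y ** x) = (x ** y) ** x.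
Proof.
pose t := R x * (L x)^-1.
have tE z : t z = ldiv x (z ** x) by rewrite permM RpermE ldivE.
have It : t \in Inn Q.
  by apply: innP; rewrite ?groupM ?groupV ?L_Mlt ?R_Mlt // tE lone_l ldivxx.
have tx : t x = x by rewrite tE mulKl.
have := innM It x y; rewrite tx !tE => /(congr1 (lmul Q x)).
by rewrite !ldivK.
Qed.

Definition linv x := ldiv x one.

Lemma mulxV x : x ** linv x = one. Proof. exact: ldivK. Qed.

Lemma mulVx x : linv x ** x = one.
Proof.
by apply: (@mul_injl x); rewrite flexible mulxV lone_l lone_r.
Qed.

Lemma linvE x y : x ** y = one -> linv x = y.
Proof. by move=> xy; rewrite /linv -xy mulKl. Qed.

Lemma linvK : involutive linv.
Proof. by move=> x; apply/linvE/mulVx. Qed.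

Lemma linv1 : linv one = one. Proof. exact/linvE/lone_l. Qed.

Lemma inn_linv f x : f \in Inn Q -> f (linv x) = linv (f x).
Proof. by move=> If; rewrite inn_ldiv ?inn1. Qed.

Lemma linn_fix x y : linn x y x = x.
Proof. by rewrite linnE flexible mulKl. Qed.

(* The automorphism [linn x y] with [x = a b] and [x y = a] fixes [x], maps [y^-1] to
   [b], and sends the identity [y (y \ x^-1) = x^-1] to [b^-1 a^-1 = x^-1]. *)
Lemma linvM a b : linv (a ** b) = linv b ** linv a.
Proof.
set x := a ** b; pose y := ldiv x a; pose f := linn x y.
have If : f \in Inn Q := linn_Inn x y.
have fE z : f z = ldiv a (x ** (y ** z)) by rewrite /f linnE ldivK.
have fy : f y = linv b.
  apply: (can_inj linvK); rewrite linvK -inn_linv // fE mulxV lone_r.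
  exact: mulKl.
have fyx : f (ldiv y (linv x)) = linv a by rewrite fE ldivK mulxV.
by rewrite -fy -fyx -innM // ldivK inn_linv // /f linn_fix.
Qed.

(** * The inversion map and the 2-core of the multiplication group *)

Definition Jperm := perm (inv_inj linvK).

Lemma JE x : Jperm x = linv x. Proof. exact: permE. Qed.

Lemma JJ : Jperm * Jperm = 1.
Proof. by apply/permP=> x; rewrite permM !JE linvK perm1. Qed.

Lemma JV : Jperm^-1 = Jperm. Proof. by apply/eqP; rewrite eq_invg_mul JJ. Qed.

Lemma LJ x : L x ^ Jperm = R (linv x).
Proof.
apply/permP=> z; rewrite conjgE JV !permM !JE LpermE RpermE linvM linvK.
by [].
Qed.

Lemma RJ x : R x ^ Jperm = L (linv x).
Proof. by rewrite -{1}[x]linvK -LJ -conjgM JJ conjg1. Qed.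

Lemma J_norm : Jperm \in 'N(Mlt Q).
Proof.
rewrite -sub1set norms_gen // sub1set inE; apply/subsetP=> _ /imsetP[f Gf ->].
case/setUP: Gf => /imsetP[x _ ->]; rewrite inE.
  by rewrite LJ imset_f ?orbT.
by rewrite RJ imset_f.
Qed.

Lemma inn_comm_J f : f \in Inn Q -> Jperm ^ f = Jperm.
Proof.
move=> If; apply/permP=> x; rewrite conjgE !permM !JE inn_linv // permKV.
by [].
Qed.

(** Up to an inner left factor, which commutes with [Jperm], [g] is the translation [L (g one)]. *)
Lemma J_conj_Mlt g : g \in Mlt Q -> Jperm ^ g = Jperm ^ L (g one).
Proof.
move=> Gg; pose h := g * (L (g one))^-1.
have Ih : h \in Inn Q.
  apply: innP; first by rewrite groupM ?groupV ?L_Mlt.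
  by rewrite permM ldivE ldivxx.
transitivity (Jperm ^ (h * L (g one))); first by rewrite mulgKV.
by rewrite conjgM (inn_comm_J Ih).
Qed.

Definition Pperm a := (R (linv a))^-1 * L a.

Lemma PE a : Pperm a = Jperm * Jperm ^ L a.
Proof. by rewrite /Pperm conjgE !mulgA -LJ conjgE JV !invMg JV ?mulgA. Qed.

Lemma P_one : Pperm one = 1.
Proof. by rewrite /Pperm linv1 R_one L_one invg1 mulg1. Qed.

(** Conjugating [L a * L a = p * L (a ** a)] by [Jperm], which commutes with the inner mapping [p],
    gives the analogue for right translations with the same [p], so [p] cancels. *)
Lemma P_sqr a : Pperm a * Pperm a = Pperm (a ** a).
Proof.
have Ip := linn_Inn a a; set p := linn a a in Ip.
have LL : L a * L a = p * L (a ** a) by rewrite /p mulgKV.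
have RR : R (linv a) * R (linv a) = p * R (linv (a ** a)).
  rewrite -!LJ -!conjMg LL conjMg; congr (_ * _).
  by apply/conjg_fixP/commgP/commute_sym/commgP/conjg_fixP/inn_comm_J.
have RRV : (R (linv a))^-1 * (R (linv a))^-1 = (R (linv (a ** a)))^-1 * p^-1.
  by rewrite -!invMg RR.
(* The inner mapping [b] fixes [a], so it commutes with [L a]; by flexibility so does [R a]. *)
have comm : commute (L a) (R (linv a)).
  pose b := R (linv a) * R a.
  have bE z : b z = z ** linv a ** a by rewrite permM !RpermE.
  have Ib : b \in Inn Q.
    by apply: innP; rewrite ?groupM ?R_Mlt // bE lone_l mulVx.
  have ba : b a = a by rewrite bE mulxV lone_l.
  have La : commute (L a) (R a).
    by apply/permP=> z; rewrite !permM !LpermE !RpermE flexible.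
  rewrite -[R (linv a)](mulgK (R a)); apply: commuteM; last exact: commuteV.
  by rewrite /commute innL ?ba.
rewrite /Pperm mulgA -[_ * L a * _]mulgA (commuteV comm) !mulgA RRV -!mulgA LL.
by rewrite mulKg.
Qed.

Definition sqr a := a ** a.

Lemma P_expg k a : Pperm a ^+ (2 ^ k) = Pperm (iter k sqr a).
Proof.
by elim: k a => [|k IHk] a //; rewrite iterSr -IHk expnS expgM expgS expg1 P_sqr.
Qed.

Hypothesis sqr_nil : forall a, exists k, iter k sqr a = one.

(** The group is dihedral: [Jperm] inverts [Pperm a], whose order divides a power of 2. *)
Lemma J_pgroup a : 2.-group <<[set Jperm; Jperm ^ L a]>>.
Proof.
have JaV : (Jperm ^ L a)^-1 = Jperm ^ L a by rewrite -conjVg JV.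
have norJ : <[Jperm]> \subset 'N(<[Pperm a]>).
  rewrite cycle_subG; apply/normP; rewrite -cycleJ.
  suff -> : Pperm a ^ Jperm = (Pperm a)^-1 by exact: cycleV.
  have JcJ : Jperm ^ Jperm = Jperm by rewrite conjgE JJ mulg1 JV.
  by rewrite PE invMg JaV JV conjMg JcJ [_ ^ Jperm]conjgE JV [LHS]mulgA JJ mul1g.
apply: (@pgroupS _ _ (<[Pperm a]> <*> <[Jperm]>)%G).
  rewrite gen_subG subUset !sub1set.
  have Jin : Jperm \in <[Pperm a]> <*> <[Jperm]> by rewrite mem_gen // inE cycle_id orbT.
  rewrite Jin -(groupMl _ Jin) -PE.
  by rewrite mem_gen // inE cycle_id.
rewrite /= norm_joinEr // pgroupM; apply/andP; split.
  have [k ak] := sqr_nil a; apply: (@pnat_dvd _ (2 ^ k)); last exact: pnatX.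
  by rewrite order_dvdn P_expg ak P_one.
by apply: (@pnat_dvd _ 2); rewrite ?order_dvdn // expgS expg1 JJ.
Qed.

Lemma P_pcore a : Pperm a \in 'O_2(<<Mlt Q>>).
Proof.
pose G := <<Mlt Q>>%G; pose Gh := (G <*> <[Jperm]>)%G.
have memG g : (g \in G) = (g \in Mlt Q) by rewrite /= genGid.
have JGh : Jperm \in Gh by rewrite mem_gen // inE cycle_id orbT.
have sGGh : G \subset Gh by rewrite joing_subl.
have J_core : Jperm \in 'O_2(Gh).
  apply: Baer_Suzuki => // y.
  rewrite /= norm_joinEr ?cycle_subG => [|]; last first.
    by apply: (subsetP (norm_gen _)); exact: J_norm.
  case/mulsgP=> g j; rewrite memG => Gg Jj ->.
  have Jj1 : Jperm ^ j = Jperm.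
    by apply/conjg_fixP/commgP/(centsP (cycle_abelian Jperm)); rewrite ?cycle_id.
  (* As [j] fixes [Jperm], it conjugates the pair [Jperm], [Jperm ^ L (g one)] into the pair in
     question. *)
  rewrite conjgM J_conj_Mlt // -{1}Jj1 -!conjg_set1 -conjUg genJ pgroupJ.
  by rewrite conjg_set1; exact: J_pgroup.
have LGh : L a \in Gh by rewrite (subsetP sGGh) ?memG ?L_Mlt.
(* The 2-core of [Gh] meets [G] inside the 2-core of [G]. *)
apply: (subsetP (pcoreS 2 sGGh)); rewrite inE memG groupM ?groupV ?L_Mlt ?R_Mlt //=.
by rewrite PE groupM // memJ_norm // (subsetP (normal_norm (pcore_normal _ _))).
Qed.

End LoopTheory.

(** * Powers of an element, and commutative loops of exponent 2 *)

Section Powers.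

Local Open Scope group_scope.

Variables (T : finType) (Q : loop T).
Local Notation "x '**' y" := (lmul Q x y) (at level 40, left associativity).
Local Notation one := (lone Q).
Local Notation L := (Lperm Q).
Local Notation R := (Rperm Q).
Local Notation ldiv := (lldiv Q).
Hypothesis autQ : automorphic Q.

Definition lpow a n := (L a ^+ n) one.

Lemma lpowS a n : lpow a n.+1 = a ** lpow a n.
Proof. by rewrite /lpow expgSr permM LpermE. Qed.

Lemma lpow1 a : lpow a 1 = a.
Proof. by rewrite lpowS /lpow expg0 perm1 lone_r. Qed.

(** The inner mapping [f] fixes [a] by flexibility, hence all its powers; on these, [L a ^+ n] and
    [L (lpow a n)] therefore agree. *)
Lemma lpowM a n l : lpow a n ** lpow a l = lpow a (n + l).
Proof.
pose f := L a ^+ n * (L (lpow a n))^-1.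
have fE z : f z = ldiv (lpow a n) ((L a ^+ n) z) by rewrite permM ldivE.
have If : f \in Inn Q.
  by apply: innP; rewrite ?groupM ?groupV ?groupX ?L_Mlt // fE ldivxx.
have fa : f a = a.
  have La : commute (R a) (L a).
    by apply/permP=> z; rewrite !permM !LpermE !RpermE (flexible autQ).
  have -> : f a = ldiv (lpow a n) (lpow a n ** a); last exact: mulKl.
  by rewrite fE -RpermE /lpow -permM -(commuteX n La) permM RpermE lone_l.
have fpow i : f (lpow a i) = lpow a i.
  elim: i => [|i IHi]; first by rewrite /lpow expg0 perm1 (inn1 If).
  by rewrite lpowS (innM autQ If) fa IHi.
rewrite -[in LHS](fpow l) fE ldivK /lpow -permM -expgD addnC.
by [].
Qed.

Lemma subloop_gen_cycle a : subloop_gen Q [set a] = porbit (L a) one.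
Proof.
have inC n : lpow a n \in porbit (L a) one by exact: mem_porbit.
apply/setP=> y; rewrite inE; apply/forallP/idP => [/(_ (porbit (L a) one))|].
  move/implyP; apply; rewrite sub1set -{2}[a]lpow1 inC andbT /subloop_closed.
  rewrite porbit_id /=; apply/forall_inP=> _ /porbitP[i ->].
  apply/forall_inP=> _ /porbitP[j ->]; rewrite -!/(lpow a _) lpowM inC /=.
  have powB p q : exists l, lpow a q = lpow a (p + l).
    (* Exponents count modulo the order of [L a], so the second summand acts as [-p]. *)
    exists (q + p * #[L a].-1); rewrite addnCA -mulnS prednK ?order_gt0 //.
    by rewrite /lpow expgD mulnC expgM expg_order expg1n mulg1.
  apply/andP; split; first by have [l ->] := powB i j; rewrite -lpowM mulKl.
  by have [l ->] := powB j i; rewrite addnC -lpowM /lrdiv -RpermE permK.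
move/porbitP=> [n ->] S; apply/implyP=> /andP[/andP[S1 /forall_inP clS]].
rewrite sub1set => Sa; rewrite -/(lpow a n); elim: n => [|n IHn].
  by rewrite /lpow expg0 perm1.
by rewrite lpowS; case/and3P: (forall_inP (clS _ Sa) _ IHn).
Qed.

Lemma sqr_elt_order a k : elt_order Q a = (2 ^ k)%N -> iter k (sqr Q) a = one.
Proof.
have pow_sqr n i : iter i (sqr Q) (lpow a n) = lpow a (n * 2 ^ i).
  elim: i => [|i IHi]; first by rewrite muln1.
  by rewrite iterS IHi /sqr lpowM addnn -mul2n expnS mulnCA.
rewrite /elt_order subloop_gen_cycle => Ca.
by rewrite -{1}[a]lpow1 pow_sqr mul1n -Ca /lpow permX iter_porbit.
Qed.

(* [m x y z] is the product of [y] and [z] in the loop isotope with neutral element [x];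
   its full symmetry is special to automorphic loops of exponent 2. *)
Lemma card_commutative_exp2 :
  (forall x y, x ** y = y ** x) -> (forall x, x ** x = one) ->
  exists k, #|T| = (2 ^ k)%N.
Proof.
move=> mulC mulxx.
pose m x y z := x ** (ldiv x y ** ldiv x z).
have mL a x y z : a ** m x y z = m (a ** x) (a ** y) (a ** z).
  have If := linn_Inn Q a x; set f := linn Q a x in If.
  have fE t : f (ldiv x t) = ldiv (a ** x) (a ** t) by rewrite linnE ldivK.
  rewrite /m -!fE -(innM autQ If) /f linnE ldivK.
  by [].
apply: (@card_ternary T m _ _ _ _ _ one).
(* The automorphism [linn x v] is applied to [v (v \ (x \ z))]; exponent 2 enters as [v v = one]. *)
- move=> x y z; set v := ldiv x y.
  have If := linn_Inn Q x v; set f := linn Q x v in If.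
  have fE t : f t = ldiv y (x ** (v ** t)) by rewrite /f linnE ldivK.
  have := innM autQ If v (ldiv v (ldiv x z)).
  by rewrite !fE !ldivK mulxx lone_r /m => <-; rewrite ldivK.
- by move=> x y z; rewrite /m [ldiv x y ** _]mulC.
- by move=> x y; rewrite /m ldivxx lone_l ldivK.
- move=> x y z t; rewrite /m => /mul_injl/mul_injl/(congr1 (lmul Q x)).
  by rewrite !ldivK.
move=> a b x y z.
(* [m a b] is composed of left division by [a] and left translations by [a \ b] and [a], all of
   which preserve [m]. *)
have mLV c u v w : m (ldiv c u) (ldiv c v) (ldiv c w) = ldiv c (m u v w).
  by apply: (@mul_injl _ Q c); rewrite mL !ldivK.
have mE u : m a b u = a ** (ldiv a b ** ldiv a u) by [].
by rewrite !mE -mLV !mL.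
Qed.

End Powers.

(** * Quotients by normal subgroups of the multiplication group *)

Section Quotient.

Local Open Scope group_scope.

Variables (T : finType) (Q : loop T) (N : {group {perm T}}).
Local Notation "x '**' y" := (lmul Q x y) (at level 40, left associativity).
Local Notation one := (lone Q).
Hypothesis nNG : N <| <<Mlt Q>>.

(** The choice depends only on the orbit, so the fixed points of [rep] encode the orbits as a finite
    type. *)
Definition rep x := odflt x [pick y in orbit 'P N x].

Lemma rep_orbit x : rep x \in orbit 'P N x.
Proof. by rewrite /rep; case: pickP => //= _; apply: orbit_refl. Qed.

Lemma repP x y : reflect (rep x = rep y) (x \in orbit 'P N y).
Proof.
apply: (iffP idP) => [xy | e].
  have /orbit_eqP eo := xy; rewrite /rep eo.
  by case: pickP => // /(_ y); rewrite orbit_refl.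
apply: (@orbit_trans _ _ _ _ _ (rep y)); last exact: rep_orbit.
by rewrite -e orbit_sym rep_orbit.
Qed.

Lemma rep_id x : rep (rep x) == rep x.
Proof. by apply/eqP/repP/rep_orbit. Qed.

(** Normality makes the orbits of [N] blocks for [Mlt Q], that is, classes of a loop congruence. *)
Lemma rep_Mlt g x y : g \in Mlt Q -> rep x = rep y -> rep (g x) = rep (g y).
Proof.
move=> Gg /repP/orbitP[n Nn <-]; apply/repP/orbitP; exists (n ^ g).
  by rewrite memJ_norm // (subsetP (normal_norm nNG)) // mem_gen.
by rewrite /= !apermE -!permM -conjgC.
Qed.

Lemma rep_MltE g x y : g \in Mlt Q -> (rep (g x) = rep (g y)) <-> (rep x = rep y).
Proof.
move=> Gg; split; last exact: rep_Mlt.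
by move/(rep_Mlt (groupVr Gg)); rewrite !permK.
Qed.

Lemma rep_mull x y z : rep (x ** y) = rep (x ** z) <-> rep y = rep z.
Proof. by rewrite -!LpermE; apply/rep_MltE/L_Mlt. Qed.

Lemma rep_mulr x y z : rep (y ** x) = rep (z ** x) <-> rep y = rep z.
Proof. by rewrite -!RpermE; apply/rep_MltE/R_Mlt. Qed.

Local Notation orbit_rep := {x : T | rep x == x}.

Definition cls x : orbit_rep := exist _ (rep x) (rep_id x).

Lemma cls_eq x y : cls x = cls y <-> rep x = rep y.
Proof. by split=> [[] // | e]; apply/val_inj. Qed.

Lemma clsK (a : orbit_rep) : cls (val a) = a.
Proof. by apply/val_inj/eqP/(valP a). Qed.

Definition mulq (a b : orbit_rep) := cls (val a ** val b).

Lemma mulqE x y : mulq (cls x) (cls y) = cls (x ** y).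
Proof.
apply/cls_eq; transitivity (rep (rep x ** y)).
  exact/rep_mull/eqP/rep_id.
exact/rep_mulr/eqP/rep_id.
Qed.

Lemma mulq1l a : mulq (cls one) a = a.
Proof. by rewrite -[a]clsK mulqE lone_l. Qed.

Lemma mulq1r a : mulq a (cls one) = a.
Proof. by rewrite -[a]clsK mulqE lone_r. Qed.

Lemma ldivq a b : exists! x, mulq a x = b.
Proof.
rewrite -[a]clsK -[b]clsK; exists (cls (lldiv Q (val a) (val b))).
split=> [|x]; first by rewrite mulqE ldivK.
rewrite -[x]clsK mulqE => /cls_eq e; apply/cls_eq/(rep_mull (val a)).
by rewrite ldivK.
Qed.

Lemma rdivq a b : exists! y, mulq y a = b.
Proof.
rewrite -[a]clsK -[b]clsK; exists (cls (lrdiv Q (val b) (val a))).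
have rdivK : lrdiv Q (val b) (val a) ** val a = val b.
  by rewrite -RpermE permKV.
split=> [|x]; first by rewrite mulqE rdivK.
rewrite -[x]clsK mulqE => /cls_eq e; apply/cls_eq/(rep_mulr (val a)).
by rewrite rdivK.
Qed.

Definition quotient_loop := Loop mulq1l mulq1r ldivq rdivq.

Lemma Mlt_quotient_lift f : f \in Mlt quotient_loop ->
  exists2 g, g \in Mlt Q & forall x, f (cls x) = cls (g x).
Proof.
pose S := [set f : {perm orbit_rep} |
  [exists g in Mlt Q, forall x, f (cls x) == cls (g x)]].
have SP (h : {perm orbit_rep}) :
    reflect (exists2 g, g \in Mlt Q & forall x, h (cls x) = cls (g x)) (h \in S).
  rewrite inE; apply: (iffP exists_inP) => -[g Gg hg]; exists g => //.
    by move=> x; apply/eqP/(forallP hg).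
  by apply/forallP=> x; apply/eqP.
have gS : group_set S.
  apply/group_setP; split; first by apply/SP; exists 1 => // x; rewrite !perm1.
  move=> h1 h2 /SP[g1 G1 e1] /SP[g2 G2 e2]; apply/SP; exists (g1 * g2).
    exact: groupM.
  by move=> x; rewrite !permM e1 e2.
suff /subsetP sMS : Mlt quotient_loop \subset Group gS by move/sMS/SP.
rewrite gen_subG; apply/subsetP=> h /setUP[] /imsetP[a _ ->]; apply/SP.
  by exists (Lperm Q (val a)) => [|x]; rewrite ?L_Mlt // !LpermE -[in LHS](clsK a) [LHS]mulqE.
by exists (Rperm Q (val a)) => [|x]; rewrite ?R_Mlt // !RpermE -[in LHS](clsK a) [LHS]mulqE.
Qed.

(** A lift [g] of an inner mapping moves [one] within its orbit; correcting it by some [n] in [N]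
    gives an inner mapping of [Q] that induces the same map. *)
Lemma automorphic_quotient : automorphic Q -> automorphic quotient_loop.
Proof.
move=> autQ f; rewrite inE => /andP[/Mlt_quotient_lift[g Gg fg] /eqP f1] a b.
have /repP/orbitP[n Nn n1] : rep (g one) = rep one.
  by apply/cls_eq; rewrite -fg.
have Gn : n \in Mlt Q by rewrite -[Mlt Q]genGid (subsetP (normal_sub nNG)).
have Ign : g * n^-1 \in Inn Q.
  apply: innP; first by rewrite groupM ?groupV.
  by rewrite permM -n1 /= apermE permK.
have fE x : f (cls x) = cls ((g * n^-1) x).
  rewrite fg permM; apply/cls_eq/repP/orbitP; exists n => //=.
  by rewrite apermE permKV.
rewrite -[a]clsK -[b]clsK /= mulqE !fE mulqE (innM autQ Ign).
by [].
Qed.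

Lemma card_orbit_Mlt x : #|orbit 'P N x| = #|orbit 'P N one|.
Proof.
rewrite -(card_imset (mem (orbit 'P N one)) (@perm_inj _ (Lperm Q x))).
congr #|pred_of_set _|; apply/setP=> y; apply/repP/imsetP => [e|[z /repP e ->]].
  exists (lldiv Q x y); last by rewrite LpermE ldivK.
  by apply/repP/(rep_mull x); rewrite ldivK lone_r.
by rewrite LpermE -[x in RHS](lone_r Q); apply/rep_mull.
Qed.

Lemma card_quotient : #|T| = (#|orbit 'P N one| * #|{: orbit_rep}|)%N.
Proof.
rewrite -[#|T|]sum1_card (partition_big cls predT) //= mulnC -sum_nat_const.
apply: eq_bigr => a _; rewrite sum1_card -(card_orbit_Mlt (val a)).
apply: eq_card => x; rewrite unfold_in -[a in LHS]clsK.
exact/eqP/repP.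
Qed.

End Quotient.

(** * Induction on the size of the loop *)

Lemma card_automorphic_2loop (T : finType) (Q : loop T) :
  automorphic Q -> (forall a, exists k, iter k (sqr Q) a = lone Q) ->
  exists k, #|T| = 2 ^ k.
Proof.
have [n] := ubnP #|T|; elim: n T Q => // n IHn T Q /ltnSE-leTn autQ sqr_nil.
pose N := 'O_2(<<Mlt Q>>)%G.
have nNG : (N <| <<Mlt Q>>)%g by exact: pcore_normal.
have PN a : Pperm Q a \in N by exact: P_pcore.
have [j oN] : exists j, #|orbit 'P N (lone Q)| = 2 ^ j.
  have : #|orbit 'P N (lone Q)| %| 2 ^ logn 2 #|N|.
    by rewrite -(card_pgroup (pcore_pgroup 2 _)) dvdn_orbit.
  by case/(dvdn_pfactor _ _ (isT : prime 2)) => j _ ->; exists j.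
have cT := card_quotient nNG; case: (posnP j) => [j0 | j_gt0].
  have N1 : N :=: 1%g.
    apply/trivgP/subsetP=> g Ng; rewrite inE; apply/eqP/permP=> x.
    have /eqP/cards1P[y oy] : #|orbit 'P N x| = 1.
      by rewrite (card_orbit_Mlt nNG) oN j0.
    have : 'P%act x g \in orbit 'P N x by exact: mem_orbit.
    have := orbit_refl 'P N x; rewrite oy !inE => /eqP-> /eqP.
    by rewrite /= apermE perm1.
  have LR a : Lperm Q a = Rperm Q (linv Q a).
    by have := PN a; rewrite N1 inE /Pperm -eq_mulVg1 eq_sym => /eqP.
  have Va a : linv Q a = a.
    by have /permP/(_ (lone Q)) := LR a; rewrite !permE lone_l lone_r.
  apply: (card_commutative_exp2 autQ) => [x y | x].
    by rewrite -LpermE LR Va RpermE.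
  by rewrite -{2}[x]Va mulxV.
have [|a|k ck] := IHn _ (quotient_loop nNG) _ (automorphic_quotient (nNG := nNG) autQ).
- apply: leq_trans leTn; rewrite cT oN ltn_Pmull //.
    by rewrite -{1}(expn0 2) ltn_exp2l.
  by apply/card_gt0P; exists (cls N (lone Q)).
(* Iterated squares pass directly to the quotient, so the induction runs on them rather than on
   element orders. *)
- have [k ak] := sqr_nil (val a); exists k.
  have iterE i : iter i (sqr (quotient_loop nNG)) a = cls N (iter i (sqr Q) (val a)).
    elim: i => [|i IHi]; first by rewrite clsK.
    by rewrite !iterS IHi [LHS](mulqE nNG).
  by rewrite iterE ak.
by exists (j + k); rewrite cT oN ck expnD.
Qed.

Theorem theorem2p4 (T : finType) (Q : loop T) :
  automorphic Q ->
  (forall x : T, exists k : nat, elt_order Q x = 2 ^ k) ->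
  exists m : nat, #|T| = 2 ^ m.
Proof.
move=> autQ ordQ; apply: (card_automorphic_2loop autQ) => a.
by have [k ak] := ordQ a; exists k; apply: sqr_elt_order.
Qed.
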